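(* The set $\mathcal V$ of all Volterra operators on $S$ is convex. Moreover, $V\in\mathcal V$ is an extreme point of $\mathcal V$ if and only if $V$ is pure.
   Context: $S=\{x=(x_n)_{n\in\mathbb N}\in\ell^1 : x_n\ge 0,\ \sum_{n=1}^\infty x_n=1\}$; $\mathrm{Extr}(S)=\{e^{(n)}:n\in\mathbb N\}$, where $e^{(n)}$ has $n$-th coordinate $1$ and all others $0$. A quadratic operator (q.o.) is a map $V:S\to S$, $V(x)=\tilde V(x,x)$, where $(\tilde V(x,y))_k=\sum_{i,j=1}^\infty p_{ij,k}x_iy_j$ for $x,y\in S$, $k\in\mathbb N$, and $(p_{ij,k})_{i,j,k\in\mathbb N}$ satisfies $p_{ij,k}\ge 0$, $p_{ij,k}=p_{ji,k}$, $\sum_{k=1}^\infty p_{ij,k}=1$. The symmetric map $\tilde V$ is uniquely determined by $V$. A q.o. $V$ is a Volterra operator if for all $\varphi,\psi\in\mathrm{Extr}(S)$ one has $\tilde V(\varphi,\psi)\in\{\lambda\varphi+(1-\lambda)\psi:\lambda\in[0,1]\}$. $\mathcal V$ is the set of all Volterra operators; convex combinations of operators are taken pointwise. A q.o. $V$ is called pure if $\tilde V(\varphi,\psi)\in\{\varphi,\psi\}$ for all $\varphi,\psi\in\mathrm{Extr}(S)$. *)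

(* Defs.v *)
From HB Require Import structures.
From mathcomp Require Import all_boot all_order all_algebra.
From mathcomp Require Import all_classical all_reals all_analysis.
From mathcomp Require Import ring lra.

Set Implicit Arguments.
Unset Strict Implicit.
Unset Printing Implicit Defensive.

Import Order.TTheory GRing.Theory Num.Theory.

Local Open Scope classical_set_scope.
Local Open Scope ring_scope.
Local Open Scope convex_scope.

Definition extreme_point (R : numDomainType) (M : lmodType R)
    (A : set (convex_lmodType M)) (x : convex_lmodType M) : Prop :=
  A x /\ forall (y z : convex_lmodType M) (t : {i01 R}),
    A y -> A z -> 0 < t%:num -> t%:num < 1 -> x = y <| t |> z ->
    y = x /\ z = x.

(* Real sequences, as a vector space over R with the pointwise operations;
   sequences are indexed from 0. *)
Notation rseq R := (nat -> R^o).

(* The set S of the comments below; `summable` is membership in l^1. *)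
Definition simplex (R : realType) : set (convex_lmodType (rseq R)) :=
  [set x | [/\ summable [set: nat] (fun n => (x n)%:E),
               forall n, 0 <= x n &
               (\sum_(0 <= n <oo) (x n)%:E = 1)%E]].

Definition Extr (R : realType) : set (convex_lmodType (rseq R)) :=
  extreme_point (@simplex R).

Definition vertex (R : realType) (n : nat) : rseq R := fun k => (k == n)%:R.

Lemma simplexP (R : realType) (x : rseq R) :
  (forall n, 0 <= x n) -> (\sum_(0 <= n <oo) (x n)%:E = 1)%E -> simplex x.
Proof.
move=> x0 x1; split=> //; rewrite /summable.
rewrite (eq_esum (b := fun n => (x n)%:E)).
  by rewrite -nneseries_esumT ?x1 ?ltry// => n; rewrite lee_fin.
by move=> n _; rewrite /= ger0_norm.
Qed.

Lemma simplex_split (R : realType) (x : rseq R) n : simplex x ->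
  ((x n)%:E + \sum_(0 <= k <oo | k != n) (x k)%:E = 1)%E.
Proof.
move=> [_ x0 x1]; rewrite -x1 [RHS](@nneseriesD1 _ _ n)//.
by move=> k _; rewrite lee_fin.
Qed.

Lemma simplex_vertex (R : realType) n : simplex (@vertex R n).
Proof.
apply: simplexP => [k|]; first by rewrite /vertex ler0n.
rewrite (@nneseriesD1 _ _ n)//; last by move=> k _; rewrite lee_fin ler0n.
rewrite eseries0 ?adde0 /vertex ?eqxx// => k _ /= /negbTE kn.
by rewrite kn.
Qed.

Lemma vertexP (R : realType) (x : rseq R) n :
  simplex x -> (forall k, k != n -> x k = 0) -> x = vertex R n.
Proof.
move=> Sx xn; apply/funext => k; rewrite /vertex.
have [->|/xn//] := eqVneq k n.
have := simplex_split n Sx; rewrite eseries0 ?adde0; first by case.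
by move=> i _ /= /xn ->.
Qed.

Lemma Extr_vertex (R : realType) : @Extr R = range (vertex R).
Proof.
apply/seteqP; split => [x [Sx ext]|_ [n _ <-]]; last first.
  split; first exact: simplex_vertex.
  move=> y z t Sy Sz t0 t1 E.
  have [[_ y0 _] [_ z0 _]] := (Sy, Sz).
  have yz k : k != n -> y k = 0 /\ z k = 0.
    move=> /negbTE kn.
    have : t%:num * y k + (1 - t%:num) * z k = 0.
      have := congr1 (fun f : rseq R => f k) E.
      by rewrite /vertex kn => /esym.
    have := y0 k; have := z0 k => zk yk /eqP.
    rewrite paddr_eq0 ?mulr_ge0// ?subr_ge0 ?ltW//.
    rewrite !mulf_eq0 (gt_eqF t0) subr_eq0 (gt_eqF t1) /=.
    by case/andP => /eqP -> /eqP ->.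
  by split; apply: vertexP => // k /yz [].
have [_ x0 x1] := Sx.
have [n xn] : exists n, x n != 0.
  apply: contrapT => /forallNP H.
  have : (\sum_(0 <= n <oo) (x n)%:E = 0)%E.
    by apply: eseries0 => i _ _; have /negP/negPn/eqP -> := H i.
  by rewrite x1 => /eqP; rewrite eqe oner_eq0.
have xngt : 0 < x n by rewrite lt_neqAle eq_sym xn x0.
have s0 : (0 <= \sum_(0 <= k <oo | k != n) (x k)%:E)%E.
  by apply: nneseries_ge0 => k _ _; rewrite lee_fin.
have Es : (\sum_(0 <= k <oo | k != n) (x k)%:E = (1 - x n)%:E)%E.
  have := simplex_split n Sx; case: (\sum_(0 <= k <oo | _) _)%E s0 => //=.
  by move=> r _ [<-]; rewrite addrAC subrr add0r.
have xle : 0 <= 1 - x n by rewrite -lee_fin -Es.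
exists n => //; move: xle; rewrite le_eqVlt => /predU1P[xn1|xnlt].
  apply/esym/vertexP => // k kn; apply/eqP; rewrite eq_le x0 andbT.
  rewrite -lee_fin {1}xn1 -Es (@nneseriesD1 _ _ k)//; last first.
    by move=> i _; rewrite lee_fin.
  by rewrite leeDl// nneseries_ge0// => i _ _; rewrite lee_fin.
have xn1 : x n <= 1 by rewrite -subr_ge0 ltW.
pose t : {i01 R} := Itv01 (x0 n) xn1.
pose z : rseq R := fun k => if k == n then 0 else x k / (1 - x n).
have Sz : simplex z.
  apply: simplexP => [k|].
    by rewrite /z; case: ifP => // _; rewrite divr_ge0// ltW.
  rewrite (@nneseriesD1 _ _ n)//; last first.
    by move=> k _; rewrite lee_fin /z; case: ifP => // _; rewrite divr_ge0// ltW.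
  rewrite {1}/z eqxx add0e.
  under eq_eseriesr => k /negbTE kn do rewrite /z kn mulrC EFinM.
  rewrite nneseriesZl; last by move=> k _; rewrite lee_fin.
  by rewrite Es -EFinM mulVf// gt_eqF.
have [] := ext (vertex R n) z t (simplex_vertex _ _) Sz xngt.
- by rewrite /= -subr_gt0.
- apply/funext => k.
  change (x k = x n * vertex R n k + (1 - x n) * z k).
  rewrite /vertex /z; case: eqVneq => [->|_].
    by rewrite mulr1 mulr0 addr0.
  by rewrite mulr0 add0r mulrC divfK// gt_eqF.
- by [].
Qed.

Definition stochastic (R : realType) (p : nat -> nat -> nat -> R) : Prop :=
  [/\ forall i j k, 0 <= p i j k,
      forall i j k, p i j k = p j i k &
      forall i j, (\sum_(0 <= k <oo) (p i j k)%:E = 1)%E].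

(* For x, y in S and p stochastic the terms are nonnegative and the
   unordered double sum is at most 1, so that `fine` loses nothing. *)
Definition bilin (R : realType) (p : nat -> nat -> nat -> R)
    (x y : @simplex R) : rseq R :=
  fun k => fine (\esum_(ij in [set: nat * nat])
    (p ij.1 ij.2 k * (val x) ij.1 * (val y) ij.2)%:E).

(* Maps S -> S are represented by maps from S to the vector space of real
   sequences (`quad_op` requires the values to lie in S), so that pointwise
   convex combinations are those of a vector space of functions. *)
Notation opspace R := (@simplex R -> rseq R).

(* `polar V W`: W is the symmetric map attached to V; it is unique
   (lemma polar_unique). *)
Definition polar (R : realType) (V : opspace R)
    (W : @simplex R -> @simplex R -> rseq R) : Prop :=
  exists p : nat -> nat -> nat -> R,
    [/\ stochastic p, W = bilin p & forall x, V x = W x x].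

Lemma simplex_mid (R : realType) i j :
  simplex (fun k => 2^-1 * vertex R i k + 2^-1 * vertex R j k : R).
Proof.
have v0 n k : 0 <= 2^-1 * vertex R n k by rewrite mulr_ge0// ler0n.
apply: simplexP => [k|]; first by rewrite addr_ge0.
under eq_eseriesr do rewrite EFinD.
rewrite nneseriesD; do ?by move=> k _ _; rewrite lee_fin.
have E n : (\sum_(0 <= k <oo) (2^-1 * vertex R n k)%:E = (2^-1)%:E)%E.
  under eq_eseriesr do rewrite EFinM.
  rewrite nneseriesZl; last by move=> k _; rewrite lee_fin ler0n.
  by have [_ _ ->] := simplex_vertex R n; rewrite mule1.
by rewrite !E -EFinD; congr EFin; field.
Qed.

Lemma esum_vertex (R : realType) (a : nat * nat -> R) i j :
  (forall ab, 0 <= a ab) ->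
  (\esum_(ab in [set: nat * nat])
     (a ab * vertex R i ab.1 * vertex R j ab.2)%:E = (a (i, j))%:E)%E.
Proof.
move=> a0; transitivity (\esum_(ab in [set (i, j)]) (a ab)%:E)%E; last first.
  by rewrite esum_set1// lee_fin.
rewrite [RHS]esum_mkcond; apply: eq_esum => -[b c] _ /=.
  have -> : ((b, c) \in [set (i, j)]) = (b == i) && (c == j).
    by apply/idP/andP => [|[/eqP -> /eqP ->]]; rewrite inE//= => -[-> ->].
  rewrite /vertex; case: eqP => [->|_]; case: eqP => [->|_] /=;
    by rewrite ?(mulr1, mulr0, mul0r).
Qed.

Lemma polar_unique (R : realType) (V : opspace R)
    (W W' : @simplex R -> @simplex R -> rseq R) :
  polar V W -> polar V W' -> W = W'.
Proof.
move=> [p [sp -> Vp]] [q [sq -> Vq]].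
suff pq : p = q by rewrite pq.
have mid r i j : stochastic r -> forall V, (forall x, V x = bilin r x x) ->
    forall k, V (SigSub (mem_set (simplex_mid R i j))) k =
      4^-1 * (r i i k + r j j k) + 2^-1 * r i j k.
  move=> [r0 rC _] V' -> k; rewrite /bilin /=.
  pose a (ab : nat * nat) : R := 4^-1 * r ab.1 ab.2 k.
  have a0 ab : 0 <= a ab by rewrite mulr_ge0.
  pose f b c (ab : nat * nat) := (a ab * vertex R b ab.1 * vertex R c ab.2)%:E.
  have f0 b c ab : setT ab -> (0 <= f b c ab)%E.
    by rewrite lee_fin !mulr_ge0 ?ler0n.
  rewrite (eq_esum (b := fun ab => (f i i ab + f j j ab +
                                    (f i j ab + f j i ab))%E)); last first.
    by move=> ab _; rewrite /f /a -!EFinD; congr EFin; field.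
  rewrite !esumD; do ?[by move=> ab t; apply: f0
                      |by move=> ab t; apply: adde_ge0; apply: f0].
  rewrite !esum_vertex// -!EFinD /= /a /= (rC j i); by field.
have E i j k := etrans (esym (mid p i j sp V Vp k)) (mid q i j sq V Vq k).
apply/funext => i; apply/funext => j; apply/funext => k.
have := E i i k; have := E j j k; have := E i j k; lra.
Qed.

Definition quad_op (R : realType) (V : opspace R) : Prop :=
  (forall x, simplex (V x)) /\ exists W, polar V W.

Definition volterra (R : realType) : set (convex_lmodType (opspace R)) :=
  [set V : opspace R | quad_op V /\ exists2 W, polar V W &
    forall phi psi : @simplex R, Extr (val phi) -> Extr (val psi) ->
      exists t : {i01 R},
        W phi psi = (val phi : convex_lmodType (rseq R)) <| t |> val psi].

Definition pure (R : realType) (V : opspace R) : Prop :=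
  quad_op V /\ exists2 W, polar V W &
    forall phi psi : @simplex R, Extr (val phi) -> Extr (val psi) ->
      W phi psi = val phi \/ W phi psi = val psi.

(* Main.v *)
(** A quadratic operator is determined by its coefficients [p i j] in S, and it
    is Volterra (pure) iff every [p i j] lies on the segment [[e_i, e_j]] (is one
    of its ends).  Convex combinations of operators correspond to those of
    coefficients.  If V is pure and V = t V1 + (1 - t) V2, each [p i j] is an
    extreme point of S, so V1 and V2 have the same coefficients as V.  If V is
    Volterra with [p i j = t e_i + (1 - t) e_j] and 0 < t < 1, then V is the
    t-combination of the two Volterra operators obtained by replacing [p i j]
    with [e_i] and with [e_j]; extremality makes these equal, so e_i = e_j. *)

Require Import Defs.
From mathcomp Require Import all_boot all_order all_algebra.
From mathcomp Require Import all_classical all_reals all_analysis.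
From mathcomp Require Import lra.

Set Implicit Arguments.
Unset Strict Implicit.
Unset Printing Implicit Defensive.

Import Order.TTheory GRing.Theory Num.Theory.

Local Open Scope classical_set_scope.
Local Open Scope ring_scope.
Local Open Scope convex_scope.

(** * Nonnegative sums over pairs of indices *)

Lemma esum_nat2 (R : realType) (a : nat -> nat -> \bar R) :
  (forall i j, 0 <= a i j)%E ->
  (\esum_(ij in [set: nat * nat]) a ij.1 ij.2 =
   \sum_(0 <= i <oo) \sum_(0 <= j <oo) a i j)%E.
Proof.
move=> a0; rewrite nneseries_esumT; last by move=> i; apply: nneseries_ge0.
under [RHS]eq_esum do rewrite nneseries_esumT//.
rewrite esum_esum//; congr esum.
by apply/seteqP; split.
Qed.

Lemma esumZl_nat2 (R : realType) (c : R) (a : nat * nat -> \bar R) :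
  0 <= c -> (forall ij, 0 <= a ij)%E ->
  (\esum_(ij in [set: nat * nat]) (c%:E * a ij) =
   c%:E * \esum_(ij in [set: nat * nat]) a ij)%E.
Proof.
move=> c0 a0.
have E b : (\esum_(ij in [set: nat * nat]) b ij =
    \esum_(ij in [set: nat * nat]) b (ij.1, ij.2) :> \bar R)%E.
  by apply: eq_esum => -[].
rewrite E (E a) (esum_nat2 (a := fun i j => (c%:E * a (i, j))%E)); last first.
  by move=> i j; rewrite mule_ge0// lee_fin.
rewrite (esum_nat2 (a := fun i j => a (i, j)))//.
rewrite -nneseriesZl; last by move=> i _; apply: nneseries_ge0.
by apply: eq_eseriesr => i _; rewrite nneseriesZl.
Qed.

(** Tonelli for counting measures: both sides are sums over a product, matched by the bijection that
    swaps coordinates. *)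
Lemma esum_exchange (R : realType) (T1 T2 : choiceType)
    (a : T1 -> T2 -> \bar R) : (forall i j, 0 <= a i j)%E ->
  (\esum_(i in [set: T1]) \esum_(j in [set: T2]) a i j =
   \esum_(j in [set: T2]) \esum_(i in [set: T1]) a i j)%E.
Proof.
move=> a0; rewrite !esum_esum//.
rewrite (reindex_esum [set: T2 * T1] _ (fun ji => (ji.2, ji.1))).
  by congr esum; apply/seteqP; split.
split; [by []|by move=> [? ?] [? ?] _ _ [-> ->]|].
by move=> [i j] _; exists (j, i).
Qed.

(** * Quadratic operators and their coefficients *)

Lemma simplex_sum2 (R : realType) (x y : rseq R) : simplex x -> simplex y ->
  (\esum_(ij in [set: nat * nat]) (x ij.1 * y ij.2)%:E = 1)%E.
Proof.
move=> [_ x0 x1] [_ y0 y1].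
rewrite (esum_nat2 (a := fun i j => (x i * y j)%:E)); last first.
  by move=> i j; rewrite lee_fin mulr_ge0.
rewrite -[RHS]x1; apply: eq_eseriesr => i _.
under eq_eseriesr do rewrite EFinM.
by rewrite nneseriesZl ?y1 ?mule1// => j _; rewrite lee_fin.
Qed.

Lemma stochastic_simplex (R : realType) (p : nat -> nat -> nat -> R) i j :
  stochastic p -> simplex (p i j).
Proof. by case=> p0 _ p1; apply: simplexP. Qed.

Lemma simplex_le1 (R : realType) (x : rseq R) n : simplex x -> x n <= 1.
Proof.
move=> Sx; have [_ x0 _] := Sx.
rewrite -lee_fin -(simplex_split n Sx) leeDl// nneseries_ge0// => k _ _.
by rewrite lee_fin.
Qed.

Lemma bilin_term_ge0 (R : realType) (p : nat -> nat -> nat -> R)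
    (x y : @simplex R) k ij : stochastic p ->
  (0 <= (p ij.1 ij.2 k * (val x) ij.1 * (val y) ij.2)%:E)%E.
Proof.
case: x y => [x /set_mem[_ x0 _]] [y /set_mem[_ y0 _]] [p0 _ _] /=.
by rewrite lee_fin !mulr_ge0.
Qed.

(** Since [p i j k <= 1], the sum is dominated by that of [x i * y j], which is 1. It is therefore
    finite and [fine] can be removed. *)
Lemma bilinE (R : realType) (p : nat -> nat -> nat -> R)
    (x y : @simplex R) k : stochastic p ->
  (bilin p x y k)%:E = (\esum_(ij in [set: nat * nat])
    (p ij.1 ij.2 k * (val x) ij.1 * (val y) ij.2)%:E)%E.
Proof.
move=> sp; rewrite /bilin fineK// ge0_fin_numE; last first.
  by apply: esum_ge0 => ij _; exact: bilin_term_ge0.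
apply: (@le_lt_trans _ _ 1%E); last by rewrite ltry.
have Sx := set_mem (valP x); have Sy := set_mem (valP y).
rewrite -(simplex_sum2 Sx Sy); apply: le_esum => ij _.
have [_ x0 _] := Sx; have [_ y0 _] := Sy.
rewrite lee_fin -mulrA ler_piMl ?mulr_ge0//.
exact: simplex_le1 (stochastic_simplex _ _ sp).
Qed.

(** Summing over [k] first gives 1 for each pair [(i, j)]; what remains is the sum of
    [x i * y j]. *)
Lemma bilin_simplex (R : realType) (p : nat -> nat -> nat -> R)
    (x y : @simplex R) : stochastic p -> simplex (bilin p x y).
Proof.
move=> sp; have t0 k ij := bilin_term_ge0 x y k ij sp.
apply: simplexP => [k|].
  by rewrite -lee_fin bilinE//; apply: esum_ge0 => ij _.
under eq_eseriesr do rewrite bilinE//.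
rewrite nneseries_esumT; last by move=> k; apply: esum_ge0.
rewrite esum_exchange//.
have Sx := set_mem (valP x); have Sy := set_mem (valP y).
rewrite -(simplex_sum2 Sx Sy); apply: eq_esum => ij _.
rewrite -nneseries_esumT//.
have [p0 _ p1] := sp; have [_ x0 _] := Sx; have [_ y0 _] := Sy.
under eq_eseriesr do rewrite -mulrA mulrC EFinM.
rewrite nneseriesZl ?p1 ?mule1// => k _.
by rewrite lee_fin.
Qed.

Lemma bilin_vertex (R : realType) (p : nat -> nat -> nat -> R)
    (x y : @simplex R) i j : stochastic p ->
  val x = vertex R i -> val y = vertex R j -> bilin p x y = p i j.
Proof.
move=> [p0 _ _] xi yj; apply/funext => k; rewrite /bilin xi yj.
by rewrite (esum_vertex (a := fun ij => p ij.1 ij.2 k)).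
Qed.

(** [polar_unique] identifies the two bilinear maps, and their values at pairs of vertices are the
    coefficients. *)
Lemma polar_stochastic_inj (R : realType) (V : opspace R)
    (p q : nat -> nat -> nat -> R) : stochastic p -> stochastic q ->
  (forall x, V x = bilin p x x) -> (forall x, V x = bilin q x x) -> p = q.
Proof.
move=> sp sq Vp Vq.
have pq : bilin p = bilin q :> (@simplex R -> @simplex R -> rseq R).
  by apply: (@polar_unique R V); [exists p|exists q].
apply/funext => i; apply/funext => j.
pose v n : @simplex R := SigSub (mem_set (simplex_vertex R n)).
rewrite -(@bilin_vertex R p (v i) (v j))// pq.
exact: bilin_vertex.
Qed.

(** * Convex combinations of coefficients *)

Definition stoch_conv (R : realType) (t : {i01 R})
    (p q : nat -> nat -> nat -> R) : nat -> nat -> nat -> R :=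
  fun i j k => t%:num * p i j k + (1 - t%:num) * q i j k.

Lemma i01_ge0 (R : realType) (t : {i01 R}) :
  0 <= t%:num /\ 0 <= 1 - t%:num.
Proof. by split; rewrite ?subr_ge0. Qed.

Lemma stochastic_conv (R : realType) (t : {i01 R})
    (p q : nat -> nat -> nat -> R) :
  stochastic p -> stochastic q -> stochastic (stoch_conv t p q).
Proof.
have [t0 t1] := i01_ge0 t.
move=> [p0 pC p1] [q0 qC q1]; split=> [i j k|i j k|i j]; rewrite /stoch_conv.
- by rewrite addr_ge0// mulr_ge0.
- by rewrite pC qC.
- under eq_eseriesr do rewrite EFinD !EFinM.
  rewrite nneseriesD; do ?by move=> k _ _; rewrite mule_ge0// lee_fin.
  rewrite !nneseriesZl; do ?by move=> k _; rewrite lee_fin.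
  by rewrite p1 q1 !mule1 -EFinD subrKC.
Qed.

Lemma bilin_conv (R : realType) (t : {i01 R}) (p q : nat -> nat -> nat -> R)
    (x y : @simplex R) : stochastic p -> stochastic q ->
  bilin (stoch_conv t p q) x y =
  (bilin p x y : convex_lmodType (rseq R)) <| t |> bilin q x y.
Proof.
move=> sp sq; apply/funext => k; have [t0 t1] := i01_ge0 t.
change (bilin (stoch_conv t p q) x y k =
  t%:num * bilin p x y k + (1 - t%:num) * bilin q x y k).
(* In the extended reals, sums of nonnegative terms are additive and homogeneous without summability
   side conditions. *)
apply: EFin_inj; rewrite bilinE; last exact: stochastic_conv.
rewrite EFinD !EFinM !bilinE//.
rewrite -!esumZl_nat2//; do ?by move=> ij; apply: bilin_term_ge0.
rewrite -esumD; do ?by move=> ij _; rewrite mule_ge0 ?bilin_term_ge0 ?lee_fin.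
by apply: eq_esum => ij _; rewrite -!EFinM -EFinD !mulrA -!mulrDl.
Qed.

(** * Volterra and pure operators in terms of coefficients *)

(** The extreme points of S are the vertices, and [bilin p] takes the value [p i j] at the vertices
    [i] and [j]. *)
Lemma volterraP (R : realType) (V : opspace R) :
  volterra V <-> exists p, [/\ stochastic p, forall x, V x = bilin p x x &
    forall i j, exists t : {i01 R}, p i j =
      (vertex R i : convex_lmodType (rseq R)) <| t |> vertex R j].
Proof.
split=> [[_ [_ [p [sp -> Vp]] H]]|[p [sp Vp H]]].
  exists p; split=> // i j.
  pose v n : @simplex R := SigSub (mem_set (simplex_vertex R n)).
  have Ev n : Extr (val (v n)) by rewrite Extr_vertex; exists n.
  have [t Wt] := H _ _ (Ev i) (Ev j).
  by exists t; rewrite -(@bilin_vertex R p (v i) (v j)).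
have Vpolar : polar V (bilin p) by exists p.
split; first by split; [move=> x; rewrite Vp; exact: bilin_simplex
                       |exists (bilin p)].
exists (bilin p) => // x y; rewrite Extr_vertex => -[i _ xi] [j _ yj].
have [t pt] := H i j; exists t.
by rewrite (bilin_vertex sp (esym xi) (esym yj)) -xi -yj.
Qed.

Lemma pureP (R : realType) (V : opspace R) :
  pure V <-> exists p, [/\ stochastic p, forall x, V x = bilin p x x &
    forall i j, p i j = vertex R i \/ p i j = vertex R j].
Proof.
split=> [[_ [_ [p [sp -> Vp]] H]]|[p [sp Vp H]]].
  exists p; split=> // i j.
  pose v n : @simplex R := SigSub (mem_set (simplex_vertex R n)).
  have Ev n : Extr (val (v n)) by rewrite Extr_vertex; exists n.
  by rewrite -(@bilin_vertex R p (v i) (v j))//; exact: H.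
have Vpolar : polar V (bilin p) by exists p.
split; first by split; [move=> x; rewrite Vp; exact: bilin_simplex
                       |exists (bilin p)].
exists (bilin p) => // x y; rewrite Extr_vertex => -[i _ xi] [j _ yj].
by rewrite (bilin_vertex sp (esym xi) (esym yj)) -xi -yj; exact: H.
Qed.

(** * Convexity of the set of Volterra operators *)

Lemma volterra_convex (R : realType) : convex_set (@volterra R).
Proof.
move=> V1 V2 t /set_mem/volterraP[p [sp Vp pP]] /set_mem/volterraP[q [sq Vq qP]].
apply/mem_set/volterraP; exists (stoch_conv t p q); split.
- exact: stochastic_conv.
- by move=> x; rewrite bilin_conv// -Vp -Vq.
- move=> i j; have [a pa] := pP i j; have [b qb] := qP i j.
  have [t0 t1] := i01_ge0 t; have [a0 a1] := i01_ge0 a.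
  have [b0 b1] := i01_ge0 b.
  (* Mixing the points of weights [a] and [b] on the segment from [vertex R i] to [vertex R j] gives
     the point whose weight is the same mixture of [a] and [b]. *)
  have c0 : 0 <= t%:num * a%:num + (1 - t%:num) * b%:num.
    by rewrite addr_ge0// mulr_ge0.
  have c1 : t%:num * a%:num + (1 - t%:num) * b%:num <= 1.
    by nra.
  exists (Itv01 c0 c1); apply/funext => k; rewrite /stoch_conv pa qb.
  change (t%:num * (a%:num * vertex R i k + (1 - a%:num) * vertex R j k) +
    (1 - t%:num) * (b%:num * vertex R i k + (1 - b%:num) * vertex R j k) =
    (t%:num * a%:num + (1 - t%:num) * b%:num) * vertex R i k +
    (1 - (t%:num * a%:num + (1 - t%:num) * b%:num)) * vertex R j k).
  lra.
Qed.

(** * Extreme points and pure operators *)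

Lemma pure_extreme (R : realType) (V : opspace R) :
  volterra V -> pure V -> extreme_point (@volterra R) V.
Proof.
move=> VV /pureP[p [sp Vp pP]]; split=> // V1 V2 t.
move=> /volterraP[q [sq Vq _]] /volterraP[r [sr Vr _]] t0 t1 VE.
(* Uniqueness of coefficients turns the decomposition of [V] into one of [p]. *)
have pE : p = stoch_conv t q r.
  apply: (polar_stochastic_inj sp (stochastic_conv t sq sr) Vp) => x.
  by rewrite VE bilin_conv// -Vq -Vr.
have pqr i j : q i j = p i j /\ r i j = p i j.
  have [_ ext] : Extr (p i j).
    by rewrite Extr_vertex; case: (pP i j) => ->; [exists i|exists j].
  apply: (ext _ _ t) => //; try exact: stochastic_simplex.
  by rewrite {1}pE.
have qp : q = p by apply/funext => i; apply/funext => j; case: (pqr i j).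
have rp : r = p by apply/funext => i; apply/funext => j; case: (pqr i j).
by split; apply/funext => x; rewrite Vp ?Vq ?Vr ?qp ?rp.
Qed.

(* Both (i, j) and (j, i) are updated, to preserve symmetry. *)
Definition set_pair (R : realType) (p : nat -> nat -> nat -> R) (i j : nat)
    (x : rseq R) : nat -> nat -> nat -> R :=
  fun a b => if ((a, b) == (i, j)) || ((b, a) == (i, j)) then x else p a b.

Lemma stochastic_set_pair (R : realType) (p : nat -> nat -> nat -> R) i j
    (x : rseq R) : stochastic p -> simplex x -> stochastic (set_pair p i j x).
Proof.
move=> [p0 pC p1] [_ x0 x1]; split=> [a b k|a b k|a b]; rewrite /set_pair.
- by case: ifP.
- by rewrite orbC; case: ifP.
- by case: ifP.
Qed.

(** [set_pair] puts the same point at [(i, j)] and [(j, i)], and at the latter the segment is read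
    from the other end. *)
Lemma conv_vertex_swap (R : realType) i j (t : {i01 R}) : exists u : {i01 R},
  (vertex R i : convex_lmodType (rseq R)) <| t |> vertex R j =
  (vertex R j : convex_lmodType (rseq R)) <| u |> vertex R i.
Proof. by rewrite convC; eexists. Qed.

(** The point [x] is tied to [u] by an equation, so that a vertex can be supplied as such, with
    weight 1 or 0. *)
Lemma volterra_set_pair (R : realType) (p : nat -> nat -> nat -> R) i j
    (u : {i01 R}) : stochastic p ->
  (forall a b, exists t : {i01 R}, p a b =
     (vertex R a : convex_lmodType (rseq R)) <| t |> vertex R b) ->
  forall x, x = (vertex R i : convex_lmodType (rseq R)) <| u |> vertex R j ->
  simplex x ->
  volterra (fun y : @simplex R => bilin (set_pair p i j x) y y).
Proof.
move=> sp pP x xE Sx; apply/volterraP; exists (set_pair p i j x); split=> //.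
  exact: stochastic_set_pair.
move=> a b; rewrite /set_pair; case: ifP => [|_]; last exact: pP.
case/orP => /eqP[-> ->]; first by exists u.
rewrite xE; exact: conv_vertex_swap.
Qed.

Lemma extreme_pure (R : realType) (V : opspace R) :
  extreme_point (@volterra R) V -> pure V.
Proof.
move=> [/volterraP[p [sp Vp pP]] ext].
apply/pureP; exists p; split=> // i j.
have [t pt] := pP i j.
(* At weight 0 or 1, [p i j] is already a vertex; extremality only speaks of weights strictly
   between. *)
have [t0|tn0] := eqVneq t%:num 0.
  right; rewrite pt; apply/funext => k.
  change (t%:num * vertex R i k + (1 - t%:num) * vertex R j k = vertex R j k).
  by rewrite t0 mul0r add0r subr0 mul1r.
have [t1|tn1] := eqVneq t%:num 1.
  left; rewrite pt; apply/funext => k.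
  change (t%:num * vertex R i k + (1 - t%:num) * vertex R j k = vertex R i k).
  by rewrite t1 subrr mul0r mul1r addr0.
have [ge0 le1] := i01_ge0 t.
have tgt0 : 0 < t%:num by rewrite lt_neqAle eq_sym tn0.
have tlt1 : t%:num < 1 by rewrite lt_neqAle tn1 -subr_ge0.
pose q := set_pair p i j (vertex R i).
pose r := set_pair p i j (vertex R j).
have Si := simplex_vertex R i; have Sj := simplex_vertex R j.
have sq : stochastic q by exact: stochastic_set_pair.
have sr : stochastic r by exact: stochastic_set_pair.
(* Away from the pair, [q] and [r] both agree with [p]; at [(j, i)] the symmetry of [p] reduces the
   claim to [(i, j)]. *)
have pE : p = stoch_conv t q r.
  apply/funext => a; apply/funext => b; apply/funext => k.
  rewrite /stoch_conv /q /r /set_pair; case: ifP => [ab|_]; last first.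
    by rewrite -mulrDl subrKC mul1r.
  have -> : p a b k = p i j k.
    by case: sp => _ pC _; case/orP: ab => /eqP[-> ->].
  by rewrite pt.
pose Vq : opspace R := fun x => bilin q x x.
pose Vr : opspace R := fun x => bilin r x x.
have [Eq Er] : Vq = V /\ Vr = V.
  apply: (ext _ _ t) => //.
  - by apply: (@volterra_set_pair _ _ _ _ 1%:i01) => //; rewrite conv1.
  - by apply: (@volterra_set_pair _ _ _ _ 0%:i01) => //; rewrite conv0.
  - by apply/funext => x; rewrite Vp {1}pE bilin_conv.
have qr : q = r.
  apply: (@polar_stochastic_inj R V) => // x; by [rewrite -Eq|rewrite -Er].
(* No case split on [i = j] is made: in either case equal ends collapse the segment, so [p i j] is
   [vertex R i]. *)
have vij : vertex R i = vertex R j.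
  have := congr1 (fun f => f i j) qr.
  by rewrite /q /r /set_pair eqxx.
by left; rewrite pt -vij convmm.
Qed.

Theorem proposition4p3 (R : realType) :
  convex_set (@volterra R) /\
  forall V : opspace R, volterra V ->
    (extreme_point (@volterra R) V <-> pure V).
Proof.
split; first exact: volterra_convex.
by move=> V VV; split; [exact: extreme_pure|exact: pure_extreme].
Qed.
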